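(* For each integer $n\ge2$ let $f_N=f_N^{(n)}$ be the number of order-$n$ ribbon tilings of the $n$-by-$N$ strip, and let $\mu_n=\lim_{N\to\infty}\frac{\ln f_N^{(n)}}{N}$. Then, as $n\to\infty$, $$\ln n-1+o(1)\le \mu_n\le \ln n .$$
   Context: Unit squares are $[x,x+1]\times[y,y+1]$ with $x,y\in\mathbb Z$. An order-$n$ ribbon tile is a set of $n$ unit squares forming a sequence in which each square after the first is the square immediately above or immediately to the right of its predecessor. An order-$n$ ribbon tiling of a region is a covering of the region by non-overlapping order-$n$ ribbon tiles contained in it. The strip of length $N$ is the rectangle $[0,N]\times[0,n]$. The limit defining $\mu_n$ exists (the sequence $\ln f_N$ is superadditive in $N$). *)

(* Defs.v *)
From mathcomp Require Export all_boot all_order all_algebra.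
From mathcomp Require Export finmap.
From mathcomp Require Export all_classical all_reals all_analysis.
Export Order.TTheory GRing.Theory Num.Theory.
Export numFieldNormedType.Exports.

Set Implicit Arguments.
Unset Strict Implicit.
Unset Printing Implicit Defensive.

Local Open Scope classical_set_scope.
Local Open Scope ring_scope.

(* The pair (x, y) stands for the square [x, x + 1] * [y, y + 1]. *)
Definition unit_square := (int * int)%type.

Definition above_or_right : rel unit_square :=
  fun a b => (b == (a.1, a.2 + 1)) || (b == (a.1 + 1, a.2)).

Definition ribbon_tile (n : nat) (T : {fset unit_square}) : Prop :=
  exists s : seq unit_square,
    [/\ size s = n, sorted above_or_right s & T = [fset c in s]%fset].

Definition ribbon_tiling (n : nat) (R : {fset unit_square})
    (P : {fset {fset unit_square}}) : Prop :=
  [/\ forall T, T \in P -> ribbon_tile n T, trivIfset P & fcover P = R].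

(* Every tile of a tiling of R is a subset of R, so restricting P to sets of
   subsets of R loses no tiling. *)
Definition num_ribbon_tilings (n : nat) (R : {fset unit_square}) : nat :=
  #|` [fset P in fpowerset (fpowerset R) | `[< ribbon_tiling n R P >]]%fset |.

(* The squares of the rectangle [0, N] * [0, n]. *)
Definition strip (n N : nat) : {fset unit_square} :=
  [fset (x%:Z, y%:Z) | x in iota 0 N, y in iota 0 n]%fset.

Definition num_strip_tilings (n N : nat) : nat :=
  num_ribbon_tilings n (strip n N).

Definition log_growth (R : realType) (n : nat) : R^nat :=
  fun N => ln (num_strip_tilings n N)%:R / N%:R.

(* [limn] is total: it is the actual limit only when [log_growth R n]
   converges. *)
Definition mu (R : realType) (n : nat) : R := limn (log_growth R n).

(* Main.v *)
Require Import Defs.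
From mathcomp Require Import perm.
From mathcomp Require Import zify lra.

Set Implicit Arguments.
Unset Strict Implicit.
Unset Printing Implicit Defensive.

Local Open Scope classical_set_scope.
Local Open Scope ring_scope.

(* Write f_N for the number of tilings and call x + y the level of the square
   (x, y). A tile meets n consecutive levels, once each, so counting the
   squares of each level shows that exactly one tile starts on each of the
   levels 0, ..., N - 1. Ribbons cannot cross, hence the starting squares
   determine the tiling, and f_N <= n^N. In the n-by-n square every permutation
   of the n tiles is the order in which the diagonal x + y = n - 1 meets the
   tiles of some tiling, so n! <= f_n. As f is supermultiplicative, Fekete's lemma gives
   mu_n = sup_N (ln f_N / N), which lies between ln n! / n >= ln n - 1 and
   ln n; so eps = 0 works. *)

(** * Ribbon tiles as lattice paths through consecutive levels *)

Definition level (c : unit_square) : int := c.1 + c.2.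

(** On a given level a square is determined by its height, so a ribbon is encoded by its first level
    [l] and its heights [h]; the first coordinate is what puts cell [i] on level [l + i]. *)
Definition path_cell (l : int) (h : nat -> int) (i : nat) : unit_square :=
  (l + i%:Z - h i, h i).

Definition starts_at (T : {fset unit_square}) (c : unit_square) : Prop :=
  c \in T /\ forall d, d \in T -> level c <= level d.

Lemma level_path_cell l h i : level (path_cell l h i) = l + i%:Z.
Proof. by rewrite /level /=; lia. Qed.

Lemma path_cell_inj l h : injective (path_cell l h).
Proof. by move=> i j /(congr1 level); rewrite !level_path_cell; lia. Qed.

Lemma above_or_right_level a b : above_or_right a b -> level b = level a + 1.
Proof.
by rewrite /above_or_right /level => /orP[] /eqP -> /=; lia.
Qed.

(** A step to the right keeps the height and a step up raises it by one. Values of [h] from [n] on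
    are arbitrary, so [h] need not be unique. *)
Lemma ribbon_tileP n T : ribbon_tile n T <->
  exists l h, (forall i, (i.+1 < n)%N -> h i.+1 = h i \/ h i.+1 = h i + 1) /\
    T = [fset path_cell l h i | i in iota 0 n]%fset.
Proof.
split=> [[s [sz_s /(sortedP (0, 0)) s_path ->]]|[l [h [h_step ->]]]].
  set c := nth (0, 0) s.
  exists (level (c 0%N)), (fun i => (c i).2); split=> [i lt_in|].
    have := s_path i; rewrite sz_s => /(_ lt_in) /orP[] /eqP; rewrite -/(c _).
      by move=> -> /=; right.
    by move=> -> /=; left.
  have cE i : (i < n)%N -> c i = path_cell (level (c 0%N)) (fun i => (c i).2) i.
    elim: i => [|i IH] lt_in.
      by rewrite /path_cell /level; case: (c 0%N) => x y /=; congr pair; lia.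
    have := s_path i; rewrite sz_s => /(_ lt_in); rewrite -/(c _) -/(c i.+1).
    move=> /above_or_right_level; rewrite (IH (ltnW lt_in)) level_path_cell.
    by rewrite /path_cell /level; case: (c i.+1) => x y /= E; congr pair; lia.
  apply/fsetP => d; rewrite in_fset /=.
  apply/idP/idP => [/(nthP (0, 0))[i]|/imfsetP[i /=]].
    by rewrite sz_s => lt_in <-; apply/imfsetP; exists i; rewrite ?mem_iota -?cE.
  rewrite mem_iota => /andP[_ lt_in] ->; apply/(nthP (0, 0)).
  by exists i; rewrite ?sz_s // -/(c _) cE.
exists [seq path_cell l h i | i <- iota 0 n]; split.
- by rewrite size_map size_iota.
- apply/(sortedP (0, 0)) => i; rewrite size_map size_iota => lt_in.
  have lt_in' := ltnW lt_in; rewrite !(nth_map 0%N) ?size_iota //.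
  rewrite !nth_iota // !add0n.
  rewrite /above_or_right /path_cell /=.
  by case: (h_step i lt_in) => ->; apply/orP; [right|left]; apply/eqP; congr pair; lia.
- apply/fsetP => d; rewrite in_fset /=.
  by apply/imfsetP/mapP => -[i ii ->]; exists i.
Qed.

Lemma tile_start n T : (0 < n)%N -> ribbon_tile n T -> exists c, starts_at T c.
Proof.
move=> n_gt0 /ribbon_tileP[l [h [_ ->]]]; exists (path_cell l h 0); split.
  by apply/imfsetP; exists 0%N; rewrite //= mem_iota.
by move=> d /imfsetP[j /= _ ->]; rewrite !level_path_cell; lia.
Qed.

Lemma tile_end n T : (0 < n)%N -> ribbon_tile n T ->
  exists2 c, c \in T & forall d, d \in T -> level d <= level c.
Proof.
move=> n_gt0 /ribbon_tileP[l [h [_ ->]]]; exists (path_cell l h n.-1).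
  by apply/imfsetP; exists n.-1; rewrite //= mem_iota /= add0n ltn_predL.
by move=> d /imfsetP[j /=]; rewrite mem_iota => /andP[_ ?] ->; rewrite !level_path_cell; lia.
Qed.

Section TileFacts.
Variables (n : nat) (T : {fset unit_square}).
Hypothesis tileT : ribbon_tile n T.

Lemma card_ribbon_tile : #|` T| = n.
Proof.
have /ribbon_tileP[l [h [_ ->]]] := tileT.
by rewrite card_imfset /= ?undup_id ?iota_uniq ?size_iota //; apply: path_cell_inj.
Qed.

Lemma tile_level_inj : {in T &, injective level}.
Proof.
have /ribbon_tileP[l [h [_ ->]]] := tileT.
move=> _ _ /imfsetP[i _ ->] /imfsetP[j _ ->].
by rewrite !level_path_cell => /addrI [->].
Qed.

Lemma tile_next c : c \in T ->
  (forall d, d \in T -> level d <= level c) \/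
  exists2 d, d \in T & above_or_right c d.
Proof.
have /ribbon_tileP[l [h [h_step ->]]] := tileT.
move=> /imfsetP[i /=]; rewrite mem_iota => /andP[_ lt_in] ->.
have [lt_i1n|le_ni1] := ltnP i.+1 n.
  right; exists (path_cell l h i.+1).
    by apply/imfsetP; exists i.+1; rewrite //= mem_iota.
  rewrite /above_or_right /path_cell /=.
  by case: (h_step i lt_i1n) => ->; apply/orP; [right|left]; apply/eqP; congr pair; lia.
left=> d /imfsetP[j /=]; rewrite mem_iota => /andP[_ lt_jn] ->.
by rewrite !level_path_cell; lia.
Qed.

Lemma tile_prev c : c \in T ->
  starts_at T c \/ exists2 d, d \in T & above_or_right d c.
Proof.
have /ribbon_tileP[l [h [h_step ->]]] := tileT.
move=> cT; have /imfsetP[i /=] := cT; rewrite mem_iota => /andP[_ lt_in] Ec.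
case: i lt_in Ec => [|i] lt_in Ec.
  left; split=> // d /imfsetP[j /=]; rewrite mem_iota => /andP[_ lt_jn] ->.
  by rewrite Ec !level_path_cell; lia.
right; exists (path_cell l h i).
  by apply/imfsetP; exists i; rewrite //= mem_iota /= add0n ltnW.
rewrite Ec /above_or_right /path_cell /=.
by case: (h_step i lt_in) => ->; apply/orP; [right|left]; apply/eqP; congr pair; lia.
Qed.

End TileFacts.

(** * Tilings of a region, and why the starting squares determine them *)

Section Tiling.
Variables (n : nat) (R : {fset unit_square}) (P : {fset {fset unit_square}}).
Hypothesis tilingP : ribbon_tiling n R P.

Lemma tiling_cover c : c \in R -> exists2 T, T \in P & c \in T.
Proof.
have [_ _ <-] := tilingP => /bigfcupP[T /andP[TP _] cT].
by exists T.
Qed.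

Lemma tiling_sub T : T \in P -> (T `<=` R)%fset.
Proof.
have [_ _ <-] := tilingP => TP; apply/fsubsetP => c cT.
by apply/bigfcupP; exists T; rewrite ?TP.
Qed.

Lemma tiling_uniq T U c : T \in P -> U \in P -> c \in T -> c \in U -> T = U.
Proof.
have [_ /trivIfsetP triv _] := tilingP => TP UP cT cU.
apply/eqP; apply/negPn/negP => /(triv T U TP UP)/fdisjointP/(_ c cT).
by rewrite cU.
Qed.

End Tiling.

Definition joined (P : {fset {fset unit_square}}) (c d : unit_square) : Prop :=
  exists T, [/\ T \in P, c \in T & d \in T].


Definition start (P : {fset {fset unit_square}}) (c : unit_square) : Prop :=
  exists2 T, T \in P & starts_at T c.

(** Compares the tiles through [d] up to the level of [d] without naming them. When [d] is the last
    square of a tile, this already concerns the whole tile. *)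
Definition same_prefix (P Q : {fset {fset unit_square}}) (d : unit_square) :=
  forall c, level c <= level d -> joined P c d <-> joined Q c d.

Lemma same_prefixC P Q d : same_prefix P Q d -> same_prefix Q P d.
Proof. by move=> PQ c /PQ[]. Qed.

(* Induction on this weight treats the squares of one level from bottom right
   to top left, and every square after its possible predecessors. *)
Definition weight (c : unit_square) : int := c.1 + 2 * c.2.

(* The successor of b in the first tiling cannot be d, so it is the other
   square e above or right of b; the weight of e is smaller than that of d, so
   e follows b in the second tiling too, where the successor of b is d. *)
Lemma no_swap n R P Q d T U :
  ribbon_tiling n R P -> ribbon_tiling n R Q ->
  (forall e, e \in R -> weight e < weight d -> same_prefix P Q e) ->
  T \in P -> U \in Q -> d \in T -> d \in U ->
  (d.1 - 1, d.2) \in T -> (d.1, d.2 - 1) \in U -> False.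
Proof.
move=> tP tQ IH TP UQ dT dU aT; set b := (d.1, d.2 - 1) => bU.
have [tileP _ _] := tP; have [tileQ _ _] := tQ.
have bR : b \in R by apply: (fsubsetP (tiling_sub tQ UQ)).
have [V VP bV] := tiling_cover tP bR.
have dV : d \notin V.
  apply/negP => dV; have VT := tiling_uniq tP VP TP dV dT; rewrite VT in bV.
  have : b = (d.1 - 1, d.2).
    by apply: (tile_level_inj (tileP _ TP)) => //; rewrite /level /=; clear; lia.
  by case; clear; lia.
have [b_last|[e eV b_e]] := tile_next (tileP _ VP) bV.
  (* If [b] is the last square of [V], the induction hypothesis at [b] puts [V] inside [U]; both
     have [n] squares, so [V = U], which contains [d]. *)
  have sVU : (V `<=` U)%fset.
    apply/fsubsetP => c cV.
    have [] : joined Q c b.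
      apply/(IH b bR); first by rewrite /weight /=; clear; lia.
        exact: b_last.
      by exists V.
    by move=> U' [U'Q cU' bU']; rewrite (tiling_uniq tQ UQ U'Q bU bU').
  have /eqP VU : V == U.
    by rewrite eqEfcard sVU (card_ribbon_tile (tileP _ VP)) (card_ribbon_tile (tileQ _ UQ)) /=.
  by rewrite VU dU in dV.
have eE : e = (d.1 + 1, d.2 - 1).
  move: b_e => /orP[] /eqP; rewrite /b /= => eE //.
  have ed : e = d by rewrite eE; case: (d) => x y /=; congr pair; clear; lia.
  by rewrite -ed eV in dV.
have eR : e \in R by apply: (fsubsetP (tiling_sub tP VP)).
have [] : joined Q b e.
  apply/(IH e eR); last by exists V.
    by rewrite eE /weight /=; clear; lia.
  by rewrite eE /level /=; clear; lia.
move=> U' [U'Q bU' eU']; have U'U := tiling_uniq tQ U'Q UQ bU' bU.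
rewrite U'U in eU'.
have : e = d.
  by apply: (tile_level_inj (tileQ _ UQ) eU' dU); rewrite eE /level /=; clear; lia.
by rewrite eE; case: (d) => x y [] /=; clear; lia.
Qed.

(** Equal starts prevent [d] from having a predecessor in one tiling only. If both tilings have one,
    [no_swap] makes the predecessors equal, and the induction hypothesis there, at smaller weight,
    supplies the rest of the prefix. *)
Lemma joined_step n R P Q d :
  ribbon_tiling n R P -> ribbon_tiling n R Q ->
  (forall c, start P c <-> start Q c) ->
  (forall e, e \in R -> weight e < weight d -> same_prefix P Q e) ->
  d \in R -> forall c, level c <= level d -> joined P c d -> joined Q c d.
Proof.
move=> tP tQ startPQ IH dR c le_cd [T [TP cT dT]].
have [tileP _ _] := tP; have [tileQ _ _] := tQ.
have [U UQ dU] := tiling_cover tQ dR.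
have in_top : level d <= level c -> joined Q c d.
  move=> le_dc; have -> : c = d.
    by apply: (tile_level_inj (tileP _ TP)) => //; apply/eqP; rewrite eq_le le_cd.
  by exists U.
have [[_ d_first]|[a aT a_d]] := tile_prev (tileP _ TP) dT; first exact/in_top/d_first.
have [d_start|[b bU b_d]] := tile_prev (tileQ _ UQ) dU.
  have [|T' T'P [dT' d_first]] := (startPQ d).2; first by exists U.
  have T'T := tiling_uniq tP T'P TP dT' dT; rewrite T'T in d_first.
  by have := d_first a aT; rewrite (above_or_right_level a_d); clear; lia.
have [/in_top //|lt_cd] := leP (level d) (level c).
(* Of the four ways to step into [d], the two mixed ones contradict [no_swap], once with the tilings
   exchanged. *)
have ab : a = b.
  move: a_d b_d => /orP[] /eqP d_a /orP[] /eqP d_b.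
  - move: d_a; rewrite d_b; case: (a) (b) => [x y] [x' y'] /= [eq_x eq_y].
    by congr pair; move: eq_x eq_y; clear; lia.
  - exfalso; apply: (no_swap tQ tP _ UQ TP dU dT) => [e eR lt_ed||].
    + exact/same_prefixC/IH.
    + suff -> : (d.1 - 1, d.2) = b by []; rewrite d_b.
      by case: (b) => x y /=; congr pair; clear; lia.
    + suff -> : (d.1, d.2 - 1) = a by []; rewrite d_a.
      by case: (a) => x y /=; congr pair; clear; lia.
  - exfalso; apply: (no_swap tP tQ IH TP UQ dT dU).
    + suff -> : (d.1 - 1, d.2) = a by []; rewrite d_a.
      by case: (a) => x y /=; congr pair; clear; lia.
    + suff -> : (d.1, d.2 - 1) = b by []; rewrite d_b.
      by case: (b) => x y /=; congr pair; clear; lia.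
  - move: d_a; rewrite d_b; case: (a) (b) => [x y] [x' y'] /= [eq_x eq_y].
    by congr pair; move: eq_x eq_y; clear; lia.
rewrite -ab in bU b_d => {b ab}.
have aR : a \in R by apply: (fsubsetP (tiling_sub tP TP)).
have [] : joined Q c a.
  apply/(IH a aR).
  - by move: a_d => /orP[] /eqP ->; rewrite /weight /=; clear; lia.
  - by have := above_or_right_level a_d; move: lt_cd; clear; lia.
  - by exists T.
by move=> U' [U'Q cU' aU']; exists U'; split=> //; rewrite (tiling_uniq tQ U'Q UQ aU' bU).
Qed.

(** The weight is nonnegative on [R], so induction on it gives equal prefixes at every square.
    Applied to the last square of a tile, this gives an inclusion between tiles, which is an
    equality as both have [n] squares. *)
Lemma start_determines_tiling n R P Q : (0 < n)%N ->
  (forall c, c \in R -> 0 <= c.1 /\ 0 <= c.2) ->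
  ribbon_tiling n R P -> ribbon_tiling n R Q ->
  (forall c, start P c <-> start Q c) -> P = Q.
Proof.
move=> n_gt0 R_ge0 tP tQ startPQ.
have agree m d : d \in R -> weight d < m%:Z -> same_prefix P Q d.
  elim: m d => [|m IHm] d dR lt_dm.
    have [d1_ge0 d2_ge0] := R_ge0 d dR.
    by move: lt_dm d1_ge0 d2_ge0; rewrite /weight; case: (d) => x y /=; clear; lia.
  have IH e : e \in R -> weight e < weight d -> same_prefix P Q e.
    by move=> eR lt_ed; apply: IHm => //; move: lt_ed lt_dm; clear; lia.
  move=> c le_cd; split; first exact: (joined_step tP tQ).
  apply: (joined_step tQ tP) => // [b|e eR lt_ed].
    by split=> /startPQ.
  exact/same_prefixC/IH.
have agreeR d : d \in R -> same_prefix P Q d.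
  by move=> dR; apply: (agree `|weight d|.+1) => //; lia.
have sub P' Q' : ribbon_tiling n R P' -> ribbon_tiling n R Q' ->
    (forall d, d \in R -> same_prefix P' Q' d) -> (P' `<=` Q')%fset.
  move=> tP' tQ' PQ; apply/fsubsetP => T TP.
  have [tileP _ _] := tP'; have [tileQ _ _] := tQ'.
  have [d dT d_last] := tile_end n_gt0 (tileP _ TP).
  have dR : d \in R by apply: (fsubsetP (tiling_sub tP' TP)).
  have [U UQ dU] := tiling_cover tQ' dR.
  suff /eqP-> : T == U by [].
  rewrite eqEfcard (card_ribbon_tile (tileP _ TP)) (card_ribbon_tile (tileQ _ UQ)) leqnn andbT.
  apply/fsubsetP => c cT; have [] : joined Q' c d.
    by apply/(PQ d dR); [exact: d_last|exists T].
  by move=> U' [U'Q cU' dU']; rewrite (tiling_uniq tQ' UQ U'Q dU dU').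
apply/eqP; rewrite eqEfsubset !sub // => d dR; exact/same_prefixC/agreeR.
Qed.

(** * The strip: one start on each level, and the bound f_N <= n^N *)

Lemma stripP n N c :
  reflect (exists x y : nat, [/\ (x < N)%N, (y < n)%N & c = (x%:Z, y%:Z)])
          (c \in strip n N).
Proof.
apply: (iffP (imfset2P _ _ _ _ _)) => /=.
  move=> [x]; rewrite mem_iota => /andP[_ ltx] [y]; rewrite mem_iota => /andP[_ lty] ->.
  by exists x, y.
by move=> [x [y [ltx lty ->]]]; exists x; rewrite ?mem_iota //; exists y; rewrite ?mem_iota.
Qed.

Lemma sum_strip n N (F : unit_square -> nat) :
  (\sum_(c <- strip n N) F c = \sum_(x < N) \sum_(y < n) F (x%:Z, y%:Z)%R)%N.
Proof.
rewrite big_imfset2 /=; last by move=> [x y] [x' y'] _ _ /= [-> ->].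
rewrite undup_id ?iota_uniq // -[X in iota 0 X]subn0 big_mkord.
by apply: eq_bigr => x _; rewrite undup_id ?iota_uniq // -[X in iota 0 X]subn0 big_mkord.
Qed.

Lemma card_strip n N : #|` strip n N| = (N * n)%N.
Proof.
have := sum_strip n N (fun=> 1%N); rewrite sum1_size => ->.
by under eq_bigr do rewrite sum1_card card_ord; rewrite sum_nat_const card_ord.
Qed.

(** A tile meets level [m] exactly when it starts on one of the levels m - n + 1, ..., m, and then
    in one square. This turns counts of squares into counts of starts. *)
Lemma sum_tile_level n T c (m : int) : ribbon_tile n T -> starts_at T c ->
  (\sum_(d <- T) (level d == m) = \sum_(i < n) (level c == m - i%:Z)%R)%N.
Proof.
move=> /ribbon_tileP[l [h [_ ->]]] [/imfsetP[i0 /=]].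
rewrite mem_iota => /andP[_ lt_i0n] -> c_first.
have n_gt0 : (0 < n)%N by apply: leq_trans lt_i0n.
have i0_0 : i0 = 0%N.
  have := c_first (path_cell l h 0); rewrite !level_path_cell.
  have -> : path_cell l h 0 \in [fset path_cell l h i | i in iota 0 n]%fset.
    by apply/imfsetP; exists 0%N; rewrite //= mem_iota.
  by move=> /(_ isT); clear; lia.
rewrite i0_0 big_imfset /=; last by move=> i j _ _; apply: path_cell_inj.
rewrite undup_id ?iota_uniq // -[X in iota 0 X]subn0 big_mkord.
apply: eq_bigr => i _; rewrite !level_path_cell; congr (nat_of_bool _); clear; lia.
Qed.

Definition starts_on (T : {fset unit_square}) (m : int) : bool :=
  `[< exists2 c, starts_at T c & level c = m >].

Lemma starts_onE T c m : starts_at T c -> starts_on T m = (level c == m).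
Proof.
move=> [cT c_first]; apply/asboolP/eqP => [[d [dT d_first] <-]|<-].
  by apply/eqP; rewrite eq_le c_first ?d_first.
by exists c.
Qed.

(* Both sides satisfy the same recurrence: the sum of either one over n
   consecutive levels is the number of squares of the strip on the last of these levels. *)
Lemma sum_starts_on n N P m : (0 < n)%N -> ribbon_tiling n (strip n N) P ->
  (\sum_(T <- P) starts_on T m = \sum_(x < N) (x%:Z == m))%N.
Proof.
move=> n_gt0 tP; have [tileP trivP coverP] := tP.
have rec k : (\sum_(i < n) \sum_(T <- P) starts_on T (k - i%:Z)%R
    = \sum_(i < n) \sum_(x < N) (x%:Z == k - i%:Z)%R)%N.
  rewrite exchange_big [RHS]exchange_big /=.
  transitivity (\sum_(d <- strip n N) (level d == k))%N.
    rewrite -coverP big_trivIfset // big_seq [RHS]big_seq.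
    apply: eq_bigr => T /tileP tileT; have [c c_start] := tile_start n_gt0 tileT.
    rewrite (sum_tile_level k tileT c_start); apply: eq_bigr => i _.
    by rewrite (starts_onE _ c_start).
  rewrite sum_strip; apply: eq_bigr => x _; apply: eq_bigr => y _.
  by congr (nat_of_bool _); rewrite /level /=; clear; lia.
(* The induction begins at negative levels, where both sides vanish. Afterwards [rec] at [m]
   isolates the term [i = 0], the terms on lower levels being known. *)
have main k : forall m, m < k%:Z ->
    (\sum_(T <- P) starts_on T m = \sum_(x < N) (x%:Z == m))%N.
  elim: k => [|k IHk] {}m lt_mk.
    rewrite big_seq !big1 // => [x _|T TP].
      by apply/eqP; rewrite eqb0; move: lt_mk; clear; lia.
    have [c c_start] := tile_start n_gt0 (tileP T TP).
    have /stripP[x [y [_ _ cE]]] := fsubsetP (tiling_sub tP TP) c c_start.1.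
    apply/eqP; rewrite (starts_onE _ c_start) eqb0 cE /level /=; move: lt_mk; clear; lia.
  have := rec m; case: (n) n_gt0 => // n' _; rewrite !big_ord_recl subr0.
  rewrite (eq_bigr (fun i : 'I_n' => \sum_(x < N) (x%:Z == m - (lift ord0 i)%:Z)%R)%N).
    by move=> /addIn.
  by move=> i _; apply: IHk; rewrite lift0; move: lt_mk; clear; lia.
by apply: (main `|m|.+1); clear; lia.
Qed.

(** For [l < N] the count in [sum_starts_on] is 1, which singles out one tile, and a tile has only
    one square on its first level. *)
Lemma unique_start n N P (l : nat) : (0 < n)%N -> ribbon_tiling n (strip n N) P ->
  (l < N)%N -> exists2 c, start P c /\ level c = l%:Z &
    forall d, start P d -> level d = l%:Z -> d = c.
Proof.
move=> n_gt0 tP lt_lN; have [tileP _ _] := tP.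
have := sum_starts_on l n_gt0 tP.
rewrite (bigD1 (Ordinal lt_lN)) //= eqxx [X in (_ + X)%N]big1 => [|x /eqP neq_x]; last first.
  by apply/eqP; rewrite eqb0; apply/eqP => - [E]; apply: neq_x; apply: val_inj.
move=> /sum_nat_seq_eq1[T [TP _ T_on T_uniq]].
have [c c_start] := tile_start n_gt0 (tileP _ TP).
have c_l : level c = l by apply/eqP; move: T_on; rewrite (starts_onE _ c_start); case: eqP.
exists c => [|d [U UP d_start] d_l]; first by split=> //; exists T.
have [UT|/T_uniq/(_ UP isT)] := eqVneq U T; last first.
  by rewrite (starts_onE _ d_start) d_l eqxx.
rewrite UT in d_start; apply: (tile_level_inj (tileP _ TP)); [by case: d_start|by case: c_start|].
by rewrite c_l.
Qed.

Lemma start_level_lt n N P c : (0 < n)%N -> ribbon_tiling n (strip n N) P ->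
  start P c -> exists2 l : nat, (l < N)%N & level c = l%:Z.
Proof.
move=> n_gt0 tP [T TP c_start].
have : (0 < \sum_(x < N) (x%:Z == level c))%N.
  rewrite -(sum_starts_on (level c) n_gt0 tP) (big_rem T) //=.
  by rewrite (starts_onE _ c_start) eqxx.
rewrite lt0n => /negP sum_neq0.
have [x /eqP xE|no_x] := pickP (fun x : 'I_N => x%:Z == level c).
  by exists x.
by case: sum_neq0; rewrite big1 // => x _; rewrite no_x.
Qed.

(** A tiling is coded by the height of the starting square on each of the [N] levels. The code
    recovers all starts, hence the tiling, and there are [n ^ N] codes. *)
Lemma num_strip_tilings_le n N : (0 < n)%N -> (num_strip_tilings n N <= n ^ N)%N.
Proof.
case: n => // n _; set m := n.+1; rewrite /num_strip_tilings /num_ribbon_tilings.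
set S := (X in #|` X|); rewrite cardfE.
have tilingS (P : S) : ribbon_tiling m (strip m N) (val P).
  by have := valP P; rewrite !inE /= => /andP[_ /asboolP].
pose on P (l : 'I_N) (y : 'I_m) := `[< start P (l%:Z - y%:Z, y%:Z) >].
(* The default [ord0] is never reached: [codeP] finds a start on every level below [N]. *)
pose code (P : S) := [ffun l : 'I_N => odflt ord0 [pick y | on (val P) l y]].
have codeP (P : S) (l : 'I_N) : start (val P) (l%:Z - (code P l)%:Z, (code P l)%:Z).
  rewrite ffunE; case: pickP => [y /asboolP //|no_y].
  have [c [[T TP c_start] c_l] _] := unique_start (ltn0Sn n) (tilingS P) (ltn_ord l).
  have /stripP[x [y [_ lt_yn cE]]] := fsubsetP (tiling_sub (tilingS P) TP) c c_start.1.
  have := no_y (Ordinal lt_yn); rewrite /on asboolT //=; exists T => //.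
  suff -> : (l%:Z - y%:Z, y%:Z) = c by [].
  by rewrite cE; congr pair; move: c_l; rewrite cE /level /=; clear; lia.
have code_start P Q : code P = code Q -> forall c, start (val P) c -> start (val Q) c.
  move=> PQ c c_start; have [l lt_lN c_l] := start_level_lt (ltn0Sn n) (tilingS P) c_start.
  have [d [_ _] d_uniq] := unique_start (ltn0Sn n) (tilingS P) lt_lN.
  have := codeP Q (Ordinal lt_lN); rewrite -PQ.
  rewrite (d_uniq c c_start c_l) -(d_uniq _ (codeP P (Ordinal lt_lN))) //.
  by rewrite /level /=; clear; lia.
have code_inj : injective code.
  move=> P Q PQ; apply: val_inj.
  apply: (start_determines_tiling (ltn0Sn n) _ (tilingS P) (tilingS Q)).
    by move=> c /stripP[x [y [_ _ ->]]].
  by move=> c; split; apply: code_start.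
by have := leq_card _ code_inj; rewrite card_ffun !card_ord.
Qed.

(** * Juxtaposition of tilings and supermultiplicativity *)

(** The source of all lower bounds below: it suffices to exhibit an injective family of tilings. *)
Lemma leq_num_ribbon_tilings n R (I : finType) (f : I -> {fset {fset unit_square}}) :
  injective f -> (forall x, ribbon_tiling n R (f x)) ->
  (#|I| <= num_ribbon_tilings n R)%N.
Proof.
move=> f_inj f_tiling; rewrite /num_ribbon_tilings.
set S := (X in #|` X|); rewrite cardfE.
have fS x : f x \in S.
  rewrite !inE; apply/andP; split; last exact/asboolP.
  rewrite fpowersetE; apply/fsubsetP => T Tfx.
  by rewrite fpowersetE (tiling_sub (f_tiling x)).
by apply: (@leq_card _ _ (fun x => [` fS x]%fset)) => x y [] /f_inj.
Qed.

Lemma ribbon_tiling_union n R1 R2 P1 P2 :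
  [disjoint R1 & R2]%fset -> ribbon_tiling n R1 P1 -> ribbon_tiling n R2 P2 ->
  ribbon_tiling n (R1 `|` R2)%fset (P1 `|` P2)%fset.
Proof.
move=> /fdisjointP R12 t1 t2.
have [tile1 triv1 cover1] := t1; have [tile2 triv2 cover2] := t2.
have P12 T U : T \in P1 -> U \in P2 -> [disjoint T & U]%fset.
  move=> T1 U2; apply/fdisjointP => c cT; apply/negP => cU.
  have /R12/negP := fsubsetP (tiling_sub t1 T1) c cT.
  by apply; apply: (fsubsetP (tiling_sub t2 U2)).
split.
- by move=> T /fsetUP[/tile1|/tile2].
- apply/trivIfsetP => T U /fsetUP[T1|T2] /fsetUP[U1|U2] TU.
  + exact: (trivIfsetP _ triv1).
  + exact: P12.
  + by rewrite fdisjoint_sym P12.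
  + exact: (trivIfsetP _ triv2).
- apply/fsetP => c; rewrite inE -cover1 -cover2.
  apply/bigfcupP/orP => [[T /andP[/fsetUP TP _] cT]|].
    by case: TP => TP; [left|right]; apply/bigfcupP; exists T; rewrite ?TP.
  by case=> /bigfcupP[T /andP[TP _] cT]; exists T; rewrite // inE TP ?orbT.
Qed.

Definition translate (M : nat) (c : unit_square) : unit_square := (M%:Z + c.1, c.2).

Definition translate_set (M : nat) (T : {fset unit_square}) : {fset unit_square} :=
  (translate M @` T)%fset.

Lemma translate_inj M : injective (translate M).
Proof. by move=> [x y] [x' y'] [/addrI -> ->]. Qed.

Lemma imfset_inj (I J : choiceType) (f : I -> J) : injective f ->
  injective (fun A : {fset I} => f @` A)%fset.
Proof.
move=> f_inj A B /fsetP AB; apply/fsetP => x.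
by have := AB (f x); rewrite !mem_imfset.
Qed.

Lemma translate_set_inj M : injective (translate_set M).
Proof. exact/imfset_inj/translate_inj. Qed.

Lemma ribbon_tile_translate n M T :
  ribbon_tile n T -> ribbon_tile n (translate_set M T).
Proof.
move=> /ribbon_tileP[l [h [h_step ->]]]; apply/ribbon_tileP.
have cE i : translate M (path_cell l h i) = path_cell (M%:Z + l) h i.
  by rewrite /translate /path_cell /= !addrA.
exists (M%:Z + l), h; split=> //; apply/fsetP => c; apply/imfsetP/imfsetP => /=.
  by move=> [_ /imfsetP[i /= ii ->] ->]; exists i.
by move=> [i ii ->]; exists (path_cell l h i) => //; apply/imfsetP; exists i.
Qed.

Lemma ribbon_tiling_translate n M R P : ribbon_tiling n R P ->
  ribbon_tiling n (translate_set M R)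
    (translate_set M @` P)%fset.
Proof.
move=> [tileP /trivIfsetP trivP <-]; split.
- by move=> _ /imfsetP[T /= /tileP tileT ->]; apply: ribbon_tile_translate.
- apply/trivIfsetP => _ _ /imfsetP[T /= TP ->] /imfsetP[U /= UP ->] neqTU.
  apply/fdisjointP => _ /imfsetP[c /= cT ->].
  rewrite (mem_imfset _ _ (@translate_inj M)) /=.
  by apply: (fdisjointP (trivP T U TP UP _)) => //; apply: contraNneq neqTU => ->.
- apply/fsetP => c; apply/bigfcupP/imfsetP => /=.
    move=> [_ /andP[/imfsetP[T /= TP ->] _] /imfsetP[d /= dT ->]]; exists d => //.
    by apply/bigfcupP; exists T; rewrite ?TP.
  move=> [d /bigfcupP[T /andP[TP _] dT] ->]; exists (translate_set M T).
    by rewrite andbT; apply/imfsetP; exists T.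
  by rewrite (mem_imfset _ _ (@translate_inj M)).
Qed.

Lemma strip_add n M N :
  strip n (M + N) = (strip n M `|` translate_set M (strip n N))%fset.
Proof.
apply/fsetP => c; rewrite inE; apply/stripP/orP.
  move=> [x [y [lt_x lt_y ->]]]; have [lt_xM|le_Mx] := ltnP x M.
    by left; apply/stripP; exists x, y.
  right; apply/imfsetP; exists ((x - M)%N%:Z, y%:Z) => /=.
    by apply/stripP; exists (x - M)%N, y; rewrite ltn_subLR.
  by rewrite /translate /=; congr pair; move: le_Mx; clear; lia.
case=> [/stripP[x [y [lt_x lt_y ->]]]|/imfsetP[_ /= /stripP[x [y [lt_x lt_y ->]]] ->]].
  by exists x, y; rewrite ltn_addr.
by exists (M + x)%N, y; rewrite ltn_add2l.
Qed.

Lemma strip_translate_disjoint n M N :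
  [disjoint strip n M & translate_set M (strip n N)]%fset.
Proof.
apply/fdisjointP => _ /stripP[x [y [lt_x _ ->]]].
by apply/negP => /imfsetP[_ /= /stripP[x' [y' [_ _ ->]]] []]; move: lt_x; clear; lia.
Qed.

(** A tile of [P1] is nonempty and lies in [R1], so it cannot be one of the tiles of [Q2], which lie
    in [R2]. *)
Lemma ribbon_tiling_union_inj n R1 R2 P1 P2 Q1 Q2 : (0 < n)%N ->
  [disjoint R1 & R2]%fset -> ribbon_tiling n R1 P1 -> ribbon_tiling n R1 Q1 ->
  ribbon_tiling n R2 P2 -> ribbon_tiling n R2 Q2 ->
  (P1 `|` P2 = Q1 `|` Q2)%fset -> (P1 `<=` Q1)%fset.
Proof.
move=> n_gt0 /fdisjointP R12 tP1 tQ1 tP2 tQ2 /fsetP PQ; apply/fsubsetP => T TP1.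
have := PQ T; rewrite !inE TP1 /= => /esym/orP[//|TQ2].
have [tile1 _ _] := tP1; have [c [cT _]] := tile_start n_gt0 (tile1 T TP1).
have /R12/negP[] := fsubsetP (tiling_sub tP1 TP1) c cT.
exact: (fsubsetP (tiling_sub tQ2 TQ2)).
Qed.

(** Cutting the strip at x = M, the two pieces can be tiled independently, and the union remembers
    both tilings. *)
Lemma num_strip_tilings_supermul n M N : (0 < n)%N ->
  (num_strip_tilings n M * num_strip_tilings n N <= num_strip_tilings n (M + N))%N.
Proof.
move=> n_gt0; rewrite {1 2}/num_strip_tilings /num_ribbon_tilings.
set SM := (X in (#|` X| * _)%N); set SN := (X in (_ * #|` X|)%N).
rewrite !cardfE -card_prod.
have SMP (P : SM) : ribbon_tiling n (strip n M) (val P).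
  by have := valP P; rewrite !inE /= => /andP[_ /asboolP].
have SNP (P : SN) : ribbon_tiling n (strip n N) (val P).
  by have := valP P; rewrite !inE /= => /andP[_ /asboolP].
pose f (PQ : SM * SN) := (val PQ.1 `|` translate_set M @` val PQ.2)%fset.
have MN := strip_translate_disjoint n M N.
have NM : [disjoint translate_set M (strip n N) & strip n M]%fset by rewrite fdisjoint_sym.
apply: (@leq_num_ribbon_tilings _ _ _ f) => [[P Q] [P' Q']|[P Q]]; last first.
  by rewrite strip_add; apply: ribbon_tiling_union => //; apply: ribbon_tiling_translate.
rewrite /f /= => eqf; have eqf' := eqf; rewrite fsetUC [RHS]fsetUC in eqf'.
have tQ := ribbon_tiling_translate M (SNP Q).
have tQ' := ribbon_tiling_translate M (SNP Q').
congr pair; apply: val_inj => /=.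
  apply/eqP; rewrite eqEfsubset.
  by rewrite (ribbon_tiling_union_inj n_gt0 MN (SMP P) (SMP P') tQ tQ' eqf)
    (ribbon_tiling_union_inj n_gt0 MN (SMP P') (SMP P) tQ' tQ (esym eqf)).
apply: (imfset_inj (@translate_set_inj M)).
apply/eqP; rewrite eqEfsubset.
by rewrite (ribbon_tiling_union_inj n_gt0 NM tQ tQ' (SMP P) (SMP P') eqf')
  (ribbon_tiling_union_inj n_gt0 NM tQ' tQ (SMP P') (SMP P) (esym eqf')).
Qed.

(** * A tiling of the n-by-n square from each permutation *)

Section Square.
Variables (n : nat) (s : {perm 'I_n}).

(* With tile l starting on level l, the set of tiles that are finished before
   level m, or meet level m below tile l in the order s. *)
Definition ahead (l : 'I_n) (m : nat) : {set 'I_n} :=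
  [set j : 'I_n | (j + n <= m)%N || ((j <= m)%N && (s j < s l)%N)].

(* The y-coordinate of tile l on level m; finished tiles count because the
   lowest square of level m >= n in the n-by-n square has y = m - n + 1. *)
Definition rank (l : 'I_n) (m : nat) : nat := #|ahead l m|.

(** No tile leaves [ahead], and at most one enters: tile m + 1, just starting, if m + 1 < n, and
    otherwise tile m + 1 - n, whose last level is m. *)
Lemma rank_step l m : rank l m.+1 = rank l m \/ rank l m.+1 = (rank l m).+1.
Proof.
have sub : ahead l m \subset ahead l m.+1.
  apply/fintype.subsetP => j; rewrite !inE => /orP[le_jm|/andP[le_jm ->]].
    by rewrite (leqW le_jm).
  by rewrite (leqW le_jm) orbT.
have : (#|ahead l m.+1 :\: ahead l m| <= 1)%N.
  apply/card_le1_eqP => x y; rewrite !inE => xD yD; apply: val_inj => /=.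
  by move: xD yD (ltn_ord x) (ltn_ord y); clear; case: (s x < s l)%N; case: (s y < s l)%N; lia.
have := cardsID (ahead l m) (ahead l m.+1).
rewrite (finset.setIidPr sub) /rank; clear; lia.
Qed.

Lemma ahead_irrefl (l : 'I_n) m : (m < l + n)%N -> l \notin ahead l m.
Proof. by rewrite inE ltnn andbF orbF -ltnNge. Qed.

(** Tile [l] is not ahead of itself. This bound and the next two keep the tile inside the square:
    with y the rank and x = m - y, they give y < n, then x >= 0, then x < n. *)
Lemma rank_lt_order (l : 'I_n) m : (m < l + n)%N -> (rank l m < n)%N.
Proof.
move=> lt_m; rewrite -[X in (_ < X)%N]card_ord -cardsT; apply: proper_card.
by rewrite properT; apply: contraNneq (ahead_irrefl lt_m) => ->; rewrite inE.
Qed.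

Lemma rank_le_level (l : 'I_n) m : (l <= m < l + n)%N -> (rank l m <= m)%N.
Proof.
move=> /andP[le_lm lt_m]; rewrite -ltnS.
have le_card : (#|[set j : 'I_n | (j <= m)%N]%SET| <= m.+1)%N.
  rewrite cardE -(size_map val) -(size_iota 0 m.+1); apply: uniq_leq_size.
    by rewrite (map_inj_uniq val_inj) enum_uniq.
  by move=> _ /mapP[j + ->]; rewrite mem_enum inE mem_iota.
apply: leq_trans le_card; apply: proper_card; apply/properP; split.
  apply/fintype.subsetP => j; rewrite !inE => /orP[|/andP[//]].
    by apply: leq_trans; rewrite leq_addr.
by exists l; rewrite ?ahead_irrefl // inE.
Qed.

(** The tiles 0, ..., m - n are finished before level [m], so all of them are ahead. *)
Lemma level_lt_rank (l : 'I_n) m : (m < l + n)%N -> (m < n + rank l m)%N.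
Proof.
move=> lt_m; have le_n : (m.+1 - n <= n)%N by move: lt_m (ltn_ord l); clear; lia.
rewrite -leq_subLR.
have wi : injective (widen_ord le_n) by move=> i j [/val_inj].
rewrite -[X in (X <= _)%N]card_ord -cardsT -(card_imset _ wi); apply: subset_leq_card.
apply/fintype.subsetP => _ /imsetP[i _ ->]; rewrite inE /=.
by have := ltn_ord i; clear; lia.
Qed.

(** Whatever is ahead of [l] is ahead of [k], and so is [l] itself. This is what keeps the tiles
    disjoint. *)
Lemma ltn_rank (l k : 'I_n) m : (l <= m < l + n)%N -> (s l < s k)%N ->
  (rank l m < rank k m)%N.
Proof.
move=> /andP[le_lm lt_m] lt_s; apply: proper_card; apply/properP; split.
  apply/fintype.subsetP => j; rewrite !inE => /orP[->//|/andP[-> lt_jl]].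
  by rewrite (ltn_trans lt_jl lt_s) orbT.
by exists l; rewrite ?ahead_irrefl // inE le_lm lt_s orbT.
Qed.

(** On level n - 1 every tile has started and none is finished, so only the order [s] counts. *)
Lemma rank_diagonal (l : 'I_n) : rank l n.-1 = s l.
Proof.
have -> : rank l n.-1 = #|s @^-1: [set k : 'I_n | (k < s l)%N]%SET|.
  apply: eq_card => j; rewrite !inE.
  by have := ltn_ord j; clear; case: (s j < s l)%N; lia.
rewrite card_preimset; last exact: perm_inj.
have wi : injective (widen_ord (ltnW (ltn_ord (s l)))) by move=> i j [/val_inj].
rewrite -[RHS]card_ord -cardsT -(card_imset _ wi); apply: eq_card => k; rewrite inE.
apply/idP/imsetP => [lt_k|[i _ ->]]; last exact: ltn_ord i.
by exists (Ordinal lt_k); rewrite ?inE //; apply: val_inj.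
Qed.

Definition perm_tile (l : 'I_n) : {fset unit_square} :=
  [fset path_cell l%:Z (fun i => (rank l (l + i))%:Z) i | i in iota 0 n]%fset.

Lemma perm_tileP (l : 'I_n) c :
  reflect (exists2 m : nat, (l <= m < l + n)%N & c = (m%:Z - (rank l m)%:Z, (rank l m)%:Z))
          (c \in perm_tile l).
Proof.
apply: (iffP (imfsetP _ _ _ _)) => /= [[i]|[m /andP[le_lm lt_m] ->]].
  rewrite mem_iota => /andP[_ lt_in] ->; exists (l + i)%N => //.
  by rewrite leq_addr ltn_add2l.
exists (m - l)%N; first by rewrite mem_iota ltn_subLR.
by rewrite /path_cell subnKC // -PoszD subnKC.
Qed.

Lemma perm_tile_uniq (l k : 'I_n) c : c \in perm_tile l -> c \in perm_tile k -> l = k.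
Proof.
move=> /perm_tileP[m m_l ->] /perm_tileP[m' m_k [E Er]].
have mm' : m = m' by move: E; rewrite Er => /addIr [].
rewrite -mm' in Er m_k => {m' mm' E}.
case: (ltngtP (s l) (s k)) => [lt_s|lt_s|/val_inj/perm_inj //].
  by have := ltn_rank m_l lt_s; rewrite Er ltnn.
by have := ltn_rank m_k lt_s; rewrite Er ltnn.
Qed.

Lemma perm_tile_diagonal (l : 'I_n) : (n.-1%:Z - (s l)%:Z, (s l)%:Z) \in perm_tile l.
Proof.
apply/perm_tileP; exists n.-1; rewrite ?rank_diagonal //.
by have := ltn_ord l; clear; lia.
Qed.

Lemma perm_tile_inj : injective perm_tile.
Proof.
move=> l k lk; apply: perm_tile_uniq (perm_tile_diagonal l) _.
by rewrite -lk perm_tile_diagonal.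
Qed.

Definition perm_tiling : {fset {fset unit_square}} :=
  [fset perm_tile l | l in 'I_n]%fset.

(** Covering follows by counting: [n] disjoint tiles of [n] squares each lie inside a square of
    [n * n]. *)
Lemma perm_tilingP : ribbon_tiling n (strip n n) perm_tiling.
Proof.
have tileP l : ribbon_tile n (perm_tile l).
  apply/ribbon_tileP; exists l%:Z, (fun i => (rank l (l + i))%:Z); split=> // i _.
  by rewrite addnS; case: (rank_step l (l + i)) => ->; [left|right; rewrite -addn1 PoszD].
have triv : trivIfset perm_tiling.
  apply/trivIfsetP => _ _ /imfsetP[l /= _ ->] /imfsetP[k /= _ ->] neq_lk.
  apply/fdisjointP => c cl; apply/negP => ck; move: neq_lk.
  by rewrite (perm_tile_uniq cl ck) eqxx.
split=> //; first by move=> _ /imfsetP[l _ ->].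
apply/eqP; rewrite eqEfcard; apply/andP; split.
  apply/fsubsetP => c /bigfcupP[_ /andP[/imfsetP[l _ ->] _] /perm_tileP[m m_l ->]].
  have [_ lt_m] := andP m_l; have := rank_lt_order lt_m; have := level_lt_rank lt_m.
  have le_m := rank_le_level m_l => lt_mr lt_rn; apply/stripP.
  by exists (m - rank l m)%N, (rank l m); rewrite ltn_subLR ?(addnC (rank l m)) // subzn.
rewrite -(eqP triv) card_strip big_seq (eq_bigr (fun=> n)) => [|_ /imfsetP[l _ ->]]; last first.
  exact: card_ribbon_tile.
rewrite -big_seq big_const_seq count_predT iter_addn_0 leq_mul2l.
by rewrite card_imfset /= -?cardE ?card_ord ?leqnn ?orbT //; apply: perm_tile_inj.
Qed.

End Square.

(** The first level of a tile gives its index [l], and its height on level n - 1 gives [s l]. *)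
Lemma perm_tiling_inj n : injective (@perm_tiling n).
Proof.
move=> s t st; apply/permP => l.
have : perm_tile s l \in perm_tiling t by rewrite -st; apply/imfsetP; exists l.
move=> /imfsetP[k _ tile_eq].
have := perm_tile_diagonal s l; rewrite tile_eq => /perm_tileP[m m_k [E sl]].
have mE : m = n.-1 by move: E; rewrite sl => /addIr [].
have lk : l = k.
  have first_le (u v : {perm 'I_n}) (i j : 'I_n) : perm_tile u i = perm_tile v j -> (j <= i)%N.
    move=> ij; have : (i%:Z - (rank u i i)%:Z, (rank u i i)%:Z) \in perm_tile u i.
      apply/perm_tileP; exists i; rewrite // leqnn.
      by rewrite -[X in (X < _)%N]addn0 ltn_add2l (leq_trans _ (ltn_ord i)).
    rewrite ij => /perm_tileP[m' /andP[le_jm _] [+ E2]].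
    by rewrite E2 => /addIr[->].
  by apply/val_inj/eqP; rewrite eqn_leq (first_le _ _ _ _ tile_eq)
    (first_le _ _ _ _ (esym tile_eq)).
by apply: val_inj => /=; rewrite sl mE rank_diagonal lk.
Qed.

Lemma factorial_le_num_strip_tilings n : (n`! <= num_strip_tilings n n)%N.
Proof.
have := leq_num_ribbon_tilings (@perm_tiling_inj n) (@perm_tilingP n).
suff -> : #|{: {perm 'I_n}}| = n`! by [].
rewrite -[n in RHS]card_ord -(cardsT 'I_n) -card_perm; apply: eq_card => s; rewrite inE.
by apply/esym/fintype.subsetP => x _; rewrite inE.
Qed.

(** * Fekete's lemma, the factorial estimate and the limit *)

Definition quotients (R : realType) (a : R^nat) : set R :=
  [set a k / k%:R | k in [set k : nat | (0 < k)%N]].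

Lemma quotients_has_sup (R : realType) (a : R^nat) (C : R) :
  (forall n, a n <= C * n%:R) -> has_sup (quotients a).
Proof.
move=> a_le; split; first by exists (a 1%N / 1), 1%N.
by exists C => _ [k /= k_gt0 <-]; rewrite ler_pdivrMr ?ltr0n.
Qed.

Lemma fekete (R : realType) (a : R^nat) (C : R) :
  (forall n, 0 <= a n) -> (forall m n, a m + a n <= a (m + n)%N) ->
  (forall n, a n <= C * n%:R) ->
  a n / n%:R @[n --> \oo] --> sup (quotients a).
Proof.
move=> a_ge0 a_super a_le; have S_sup := quotients_has_sup a_le.
have a_mul k q : a k *+ q <= a (q * k)%N.
  elim: q => [|q IHq]; first by rewrite mulr0n.
  by rewrite mulrS mulSn (le_trans _ (a_super _ _)) ?lerD2l.
apply/cvgrPdist_le => e e_gt0; have e2_gt0 : 0 < e / 2 by rewrite divr_gt0.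
have [_ [k /= k_gt0 <-] lt_k] := sup_adherent e2_gt0 S_sup.
near=> N.
have N_gt0 : (0 < N)%N by near: N; exact: nbhs_infty_gt.
(* Rounding [N] down to a multiple of [k] costs at most [a k]; this choice makes that at most
   [e / 2 * N]. *)
have N_large : a k / (e / 2) <= N%:R by near: N; exact: nbhs_infty_ger.
have le_sup : a N / N%:R <= sup (quotients a) by apply: sup_upper_bound => //; exists N.
rewrite ger0_norm ?subr_ge0 // lerBlDr -lerBlDl.
apply: (@le_trans _ _ (a k / k%:R - e / 2)); first by rewrite lerBlDr; move: lt_k; clear; lra.
have kR_gt0 : 0 < k%:R :> R by rewrite ltr0n.
have NR_gt0 : 0 < N%:R :> R by rewrite ltr0n.
rewrite ler_pdivlMr //.
(* Superadditivity splits off the remainder [N %% k], whose term is dropped because it is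
   nonnegative. *)
have aN : a k * (N %/ k)%:R <= a N.
  rewrite mulr_natr (le_trans (a_mul _ _)) // [X in _ <= a X](divn_eq N k).
  by rewrite (le_trans _ (a_super _ _)) // lerDl.
have N_lt : N%:R <= (N %/ k)%:R * k%:R + k%:R :> R.
  by rewrite -natrM -natrD ler_nat {1}(divn_eq N k) leq_add2l ltnW ?ltn_mod.
apply: le_trans aN.
rewrite mulrBl; apply: (@le_trans _ _ (a k / k%:R * N%:R - a k)).
  by rewrite lerD2l lerN2 mulrC -ler_pdivrMr.
rewrite lerBlDr -mulrA -[X in _ <= _ + X]mulr1 -mulrDr ler_wpM2l // mulrC.
by rewrite ler_pdivrMr // mulrDl mul1r.
Unshelve. all: by end_near.
Qed.

(** Induction on n; the increment is controlled by n (ln (n + 1) - ln n) <= 1, which is ln (1 + x)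
    <= x at x = 1 / n. *)
Lemma ln_factorial_ge (R : realType) n : (0 < n)%N ->
  n%:R * ln n%:R - n%:R <= ln n`!%:R :> R.
Proof.
case: n => // n _; elim: n => [|n IHn]; first by rewrite ln1 mulr0 sub0r lerN10.
rewrite factS natrM lnM ?posrE ?ltr0n ?fact_gt0 //.
have n_gt0 : 0 < n.+1%:R :> R by rewrite ltr0n.
have ln_step : n.+1%:R * (ln n.+2%:R - ln n.+1%:R) <= 1 :> R.
  rewrite -ler_pdivlMl // mulr1 -ln_div ?posrE ?ltr0n //.
  rewrite -[n.+2%:R]natr1 mulrDl divff ?gt_eqF // mul1r.
  by apply: le_ln1Dx; rewrite (lt_trans _ (_ : 0 < _)) ?invr_gt0 // ltrN10.
move: IHn ln_step; set x := ln n.+2%:R; set y := ln n.+1%:R; set z := ln (n.+1)`!%:R.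
by rewrite -[n.+2%:R]natr1; move: n.+1%:R x y z => t x y z; clear; lra.
Qed.

Lemma num_ribbon_tilings_gt0 n R P :
  ribbon_tiling n R P -> (0 < num_ribbon_tilings n R)%N.
Proof.
move=> tP; rewrite -card_unit.
by apply: (@leq_num_ribbon_tilings _ _ _ (fun=> P)) => // -[] [].
Qed.

(** One column is a vertical tile, with [Posz] as its height function, and columns can be
    juxtaposed. *)
Lemma num_strip_tilings_gt0 n N : (0 < n)%N -> (0 < num_strip_tilings n N)%N.
Proof.
move=> n_gt0; elim: N => [|N IHN].
  apply: (@num_ribbon_tilings_gt0 _ _ fset0); split=> //.
    by apply/trivIfsetP => T U; rewrite inE.
  apply/fsetP => c; apply/bigfcupP/stripP => [[T]|[x [y []]] //].
  by rewrite inE.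
rewrite -(addn1 N); apply: leq_trans (num_strip_tilings_supermul N 1 n_gt0).
rewrite muln_gt0 IHN /=.
apply: (@num_ribbon_tilings_gt0 _ _ [fset strip n 1]%fset); split.
- move=> T; rewrite inE => /eqP ->; apply/ribbon_tileP.
  exists 0, Posz; split=> [i _|]; first by right; rewrite -addn1 PoszD.
  have cE i : path_cell 0 Posz i = (0%N%:Z, i%:Z) by rewrite /path_cell add0r subrr.
  apply/fsetP => c; apply/stripP/imfsetP => /= [[x [y [+ lt_y ->]]]|[i]].
    by case: x => // _; exists y; rewrite ?mem_iota ?cE.
  by rewrite mem_iota => /andP[_ lt_i] ->; exists 0%N, i; rewrite cE.
- by apply/trivIfsetP => T U; rewrite !inE => /eqP -> /eqP ->; rewrite eqxx.
- by rewrite /fcover big_seq_fset1.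
Qed.

Theorem corollary1 (R : realType) :
  (forall n : nat, (2 <= n)%N -> cvgn (log_growth R n)) /\
  exists eps : R^nat,
    (eps n @[n --> \oo] --> 0) /\
    (forall n : nat, (2 <= n)%N ->
       ln n%:R - 1 + eps n <= mu R n /\ mu R n <= ln n%:R).
Proof.
pose a n : R^nat := fun N => ln (num_strip_tilings n N)%:R.
have tilings_gt0 n N : (2 <= n)%N -> 0 < (num_strip_tilings n N)%:R :> R.
  by move=> n_ge2; rewrite ltr0n num_strip_tilings_gt0 // ltnW.
have a_le n : (2 <= n)%N -> forall N, a n N <= ln n%:R * N%:R.
  move=> n_ge2 N; have n_gt0 : (0 < n)%N by apply: ltnW.
  rewrite /a mulr_natr -lnXn ?ltr0n // -natrX.
  rewrite ler_ln ?posrE ?tilings_gt0 ?ltr0n ?expn_gt0 ?n_gt0 //.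
  by rewrite ler_nat num_strip_tilings_le.
have lim n : (2 <= n)%N -> log_growth R n N @[N --> \oo] --> sup (quotients (a n)).
  move=> n_ge2; apply: fekete (a_le n n_ge2) => [N|M N].
    by rewrite ln_ge0 // ler1n -(ltr0n R) tilings_gt0.
  rewrite -lnM ?posrE ?tilings_gt0 // ler_ln ?posrE ?mulr_gt0 ?tilings_gt0 //.
  by rewrite -natrM ler_nat num_strip_tilings_supermul // ltnW.
split=> [n n_ge2|]; first exact: cvgP (lim n n_ge2).
exists (fun=> 0); split=> [|n n_ge2]; first exact: cvg_cst.
have n_gt0 : (0 < n)%N by apply: ltnW.
have S_sup := quotients_has_sup (a_le n n_ge2).
have -> : mu R n = sup (quotients (a n)) by apply/cvg_lim/lim.
rewrite addr0; split.
  (* The supremum is tested at N = n, where the strip is the square and the factorial bound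
     applies. *)
  apply: (@le_trans _ _ (a n n / n%:R)); last by apply: sup_upper_bound => //; exists n.
  rewrite ler_pdivlMr ?ltr0n // mulrBl mul1r mulrC (le_trans (ln_factorial_ge _ n_gt0)) //.
  rewrite ler_ln ?posrE ?tilings_gt0 ?ltr0n ?fact_gt0 //.
  by rewrite ler_nat factorial_le_num_strip_tilings.
apply: ge_sup S_sup.1 _ => _ [k /= k_gt0 <-].
by rewrite ler_pdivrMr ?ltr0n // a_le.
Qed.
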